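(* Let $r(n)$ be the number of $(-1)$-Dyck paths of semi-length $n$, $a(n)$ the total area of all $(-1)$-Dyck paths of semi-length $n$, $q_n=|\mathcal{Q}_n|$, and $A_n$ the total area of all paths in $\mathcal{Q}_n$. Then: (1) For $n>4$, $$A_n=2 A_{n-1}+A_{n-2}+2 A_{n-3}+q_{n}-q_{n-1}+2n q_{n-2} +2(n-5) q_{n-3}+4 n^2-14 n+13+\sum _{i=2}^{n-4} 2\bigl(A_{i}+i q_{i} +i(i+1)\bigr) (q_{n-i-1}-q_{n-i-2}),$$ with the initial values $A_1=0$, $A_2=2$, $A_3=13$, and $A_4=58$. (2) For $n\ge 4$, the sequence $a(n)$ satisfies the recursive relation $$\begin{aligned} a(n)={}&3 a(n-1)-a(n-2)+A_{n-2}+2(n-1) q_{n-2}+2 n\, r(n-1)+2(3-n) r(n-2)\\ &-4 r(n-3)+(n-1)^2+ \sum _{i=3}^{n-2} q_{i-1} \bigl(a(n-i)-a(n-i-1)\bigr)\\ &+\sum _{i=3}^{n-2} \left(A_{i-1}+(2 i-1) q_{i-1}+i^2\right) \bigl(r(n-i)-r(n-i-1)\bigr). \end{aligned}$$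
   Context: A Dyck path is a lattice path in the first quadrant that starts at the origin, ends on the $x$-axis, and consists of steps $U=(1,1)$ and $D=(1,-1)$ (never going below the $x$-axis). Its semi-length is its number of $U$ steps. A valley is an occurrence of two consecutive steps $DU$; the level of a valley is the $y$-coordinate of its lowest point. Let $\nu=(\nu_1,\dots,\nu_k)$ be the levels of all valleys of $P$, listed from left to right. A Dyck path is called $(-1)$-Dyck if it has at most one valley or if $\nu_{i+1}-\nu_i\ge -1$ for all $1\le i<k$. $\mathcal{Q}_n$ is the set of all $(-1)$-Dyck paths of semi-length $n$ that have at least one valley and whose last (rightmost) valley is at ground level (level $0$). The area of a Dyck path is the sum of the $y$-coordinates of all lattice points visited by the path (equivalently, the area of the region between the path and the $x$-axis). Sums whose upper limit is smaller than the lower limit are empty. *)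

(* Defs.v *)
From mathcomp Require Import all_boot all_order all_algebra.

Set Implicit Arguments.
Unset Strict Implicit.
Unset Printing Implicit Defensive.

Import Order.TTheory GRing.Theory Num.Theory.
Local Open Scope ring_scope.

(* A lattice path from the origin is encoded by its word of steps:
   true is the step (1,1) and false is the step (1,-1). *)
Definition U : bool := true.
Definition D : bool := false.

(* The y-coordinate of the lattice point reached after the first k steps. *)
Definition height (w : seq bool) (k : nat) : int :=
  (count_mem U (take k w))%:Z - (count_mem D (take k w))%:Z.

Definition is_dyck (w : seq bool) : bool :=
  all (fun k => 0 <= height w k) (iota 0 (size w).+1)
  && (height w (size w) == 0).

Definition semilength (w : seq bool) : nat := count_mem U w.

(* The positions i (counted from 0) such that steps i, i+1 form a factor DU;
   the lowest point of that valley is reached after i+1 steps. *)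
Definition valleys (w : seq bool) : seq nat :=
  [seq i <- iota 0 (size w).-1 | (nth U w i == D) && (nth D w i.+1 == U)].

Definition valley_levels (w : seq bool) : seq int :=
  [seq height w i.+1 | i <- valleys w].

(* [sorted] compares consecutive valleys only, and holds vacuously when there
   is at most one valley. *)
Definition is_m1dyck (w : seq bool) : bool :=
  is_dyck w
  && sorted (fun x y : int => - 1 <= y - x) (valley_levels w).

Definition area (w : seq bool) : int :=
  \sum_(0 <= k < (size w).+1) height w k.

(* A Dyck path of semi-length n has exactly 2n steps, so words of that length
   suffice. *)
Definition m1dyck (n : nat) : {set (n.*2).-tuple bool} :=
  [set w : (n.*2).-tuple bool | is_m1dyck w & semilength w == n].

Definition Qset (n : nat) : {set (n.*2).-tuple bool} :=
  [set w : (n.*2).-tuple bool in m1dyck n | (valley_levels w != [::])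
                       && (last 0 (valley_levels w) == 0)].

Definition r (n : nat) : nat := #|m1dyck n|.
Definition a (n : nat) : int := \sum_(w in m1dyck n) area w.
Definition q (n : nat) : nat := #|Qset n|.
Definition A (n : nat) : int := \sum_(w in Qset n) area w.

(* Main.v *)
Require Import Defs.
From mathcomp Require Import all_boot all_order all_algebra.
From mathcomp Require Import zify ring.

Import Order.TTheory GRing.Theory Num.Theory.
Local Open Scope ring_scope.

(** A nonempty Dyck path is uniquely U x D y, where x and y are Dyck paths. Its
    valley levels are those of x raised by one, then a 0 if y is nonempty, then
    those of y. When y is nonempty, the path is therefore (-1)-Dyck exactly when
    y is (-1)-Dyck and x is a (-1)-Dyck path without valley or with its last
    valley on the axis; call the latter paths grounded. It is then
    grounded exactly when x and y are. When y is empty, the path is (-1)-Dyck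
    exactly when x is, and grounded exactly when x is a pyramid.

    Since area (U x D y) = area x + |x| + 1 + area y, with |x| the number of
    steps of x, this gives convolution recurrences for the numbers b and r and
    the total areas c and a of grounded and of (-1)-Dyck paths
    ([grounded_count_rec], [gentle_count_rec], [grounded_area_rec],
    [gentle_area_rec]). There is one pyramid of each semi-length n, of area n^2,
    so that b n = q n + 1 and c n = A n + n^2.

    Both claimed recurrences are differences of two consecutive convolution
    recurrences, from which the terms of index 0, 1 and the last ones have been
    separated. For the area of grounded paths the two halves of the convolution
    are first identified by symmetry, and the recurrence for b is used to
    eliminate the convolution of b with itself; this is where the term
    q n - q (n - 1) comes from. For the area of (-1)-Dyck paths the constant
    part of b = q + 1 contributes a telescoping sum. *)

(** * Heights, valleys and area of a word, step by step *)

(** The change of height caused by a step. *)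
Definition step (s : bool) : int := if s then 1 else -1.

Local Arguments height : simpl never.

Lemma height0 (w : seq bool) : height w 0 = 0.
Proof. by rewrite /height take0 /= subrr. Qed.

Lemma height_cons (s : bool) (w : seq bool) (k : nat) :
  height (s :: w) k.+1 = step s + height w k.
Proof. by rewrite /height /=; case: s; rewrite /step /U /D /=; lia. Qed.

(** [dyck_from h w] holds when [w], started at height [h], ends at height 0
    and never becomes negative. *)
Fixpoint dyck_from (h : nat) (w : seq bool) : bool :=
  match w with
  | [::] => h == 0%N
  | true :: w' => dyck_from h.+1 w'
  | false :: w' => if h is h'.+1 then dyck_from h' w' else false
  end.

Lemma all_iota_recl (p : pred nat) (n : nat) :
  all p (iota 0 n.+1) = p 0%N && all (fun k => p k.+1) (iota 0 n).
Proof.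
by rewrite -[iota 0 n.+1]/(0%N :: iota 1 n) (iotaDl 1 0) [LHS]/= all_map.
Qed.

Lemma dyck_fromE (h : nat) (w : seq bool) :
  all (fun k => 0 <= h%:Z + height w k) (iota 0 (size w).+1)
    && (h%:Z + height w (size w) == 0) = dyck_from h w.
Proof.
elim: w h => [|s w IHw] h; first by rewrite /= height0; lia.
rewrite [size _]/= height_cons all_iota_recl height0 addr0 lez_nat leq0n.
under eq_all do rewrite height_cons.
case: s; last case: h => [|h].
- rewrite -[dyck_from _ _]/(dyck_from h.+1 w) -IHw andTb /step addrA.
  congr (_ && _); last by rewrite -PoszD addn1.
  by apply: eq_all => k; rewrite addrA -PoszD addn1.
- by rewrite all_iota_recl height0.
- rewrite -[dyck_from _ _]/(dyck_from h w) -IHw andTb /step addrA.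
  have -> : h.+1%:Z + -1 = h%:Z by lia.
  congr (_ && _); apply: eq_all => k; rewrite addrA.
  by have -> : h.+1%:Z + -1 = h%:Z by lia.
Qed.

Lemma is_dyckE (w : seq bool) : is_dyck w = dyck_from 0 w.
Proof.
rewrite -dyck_fromE /is_dyck add0r; congr (_ && _).
by apply: eq_all => k; rewrite add0r.
Qed.

Lemma dyck_height_size {w : seq bool} :
  is_dyck w -> height w (size w) = 0.
Proof. by case/andP=> _ /eqP. Qed.

Lemma dyck_head (w : seq bool) : is_dyck w -> head false w = (w != [::]).
Proof. by rewrite is_dyckE; case: w => [|[] w]. Qed.

Lemma dyck_size (w : seq bool) : is_dyck w -> size w = (semilength w).*2.
Proof.
move=> /dyck_height_size; rewrite /height take_size /semilength.
rewrite -(count_predC (pred1 U) w).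
have -> : count (predC (pred1 U)) w = count_mem D w by apply: eq_count; case.
lia.
Qed.

Lemma area_cons (s : bool) (w : seq bool) :
  area (s :: w) = area w + step s * (size w).+1%:Z.
Proof.
rewrite /area /= big_nat_recl // height0 add0r.
under eq_bigr do rewrite height_cons.
rewrite big_split /= addrC; congr (_ + _).
by rewrite sumr_const_nat subn0 -mulr_natr pmulrn intz.
Qed.

Lemma area_cat (x y : seq bool) :
  area (x ++ y) = area x + area y + height x (size x) * (size y)%:Z.
Proof.
elim: x => [|s x IHx].
  by rewrite /= {2}/area big_nat1 !height0 mul0r addr0 add0r.
rewrite cat_cons !area_cons IHx height_cons size_cat.
rewrite -addn1 -[(size x).+1]addn1 !PoszD; ring.
Qed.

Lemma valley_levels_cons (s : bool) (w : seq bool) :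
  valley_levels (s :: w) =
  (if ~~ s && head false w then [:: step s] else [::])
    ++ [seq step s + l | l <- valley_levels w].
Proof.
rewrite /valley_levels /valleys; case: w => [|t w] /=.
  by rewrite andbF.
have -> : iota 1 (size w) = map S (iota 0 (size w)) by rewrite -(iotaDl 1).
rewrite filter_map -map_comp.
have -> : (s == D) && (t == U) = ~~ s && t by case: s; case: t.
case: (~~ s && t) => /=.
  rewrite height_cons height0 addr0 -!map_comp; congr (_ :: _).
  by apply: eq_map => k /=; rewrite height_cons.
by rewrite -!map_comp; apply: eq_map => k /=; rewrite height_cons.
Qed.

(** No valley is created at the junction with a word that begins with a down
    step. *)
Lemma valley_levels_cat_down (x y : seq bool) :
  valley_levels (x ++ false :: y) =
  valley_levels x
    ++ [seq height x (size x) + l | l <- valley_levels (false :: y)].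
Proof.
elim: x => [|s x IHx].
  rewrite [valley_levels [::]]/= height0 -[LHS]map_id.
  by apply: eq_map => l /=; rewrite add0r.
rewrite cat_cons valley_levels_cons IHx [in RHS]valley_levels_cons.
rewrite height_cons map_cat catA -map_comp; congr ((_ ++ _) ++ _).
- by case: x {IHx}.
- by apply: eq_map => l /=; rewrite addrA.
Qed.

Lemma dyck_valley_levels_ge0 (w : seq bool) :
  is_dyck w -> all (fun l => 0 <= l) (valley_levels w).
Proof.
case/andP=> /allP hw _; apply/allP => l /mapP[i]; rewrite mem_filter.
rewrite mem_iota => /andP[_ lti] ->; apply: hw; rewrite mem_iota.
by move: lti; case: (size w); lia.
Qed.

(** * First return decomposition *)

(** The path made of the Dyck path [x] lifted by one level, followed by [y]:
    its first return to the axis occurs just before [y]. *)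
Definition first_return (x y : seq bool) : seq bool :=
  true :: x ++ false :: y.

Lemma dyck_from_cat (k h : nat) (x z : seq bool) :
  dyck_from k x -> dyck_from (k + h) (x ++ z) = dyck_from h z.
Proof.
elim: x k => [|[] x IHx] k /=; first by move/eqP->.
- by rewrite -addSn; apply: IHx.
- by case: k => // k /IHx.
Qed.

(** The path is cut at its first descent below the level [h.+1]. *)
Lemma dyck_from_split (k h : nat) (w : seq bool) :
  dyck_from (k + h.+1) w ->
  exists x y, [/\ w = x ++ false :: y, dyck_from k x & dyck_from h y].
Proof.
elim: w k => [|[] w IHw] k /=; first by rewrite addnS.
  rewrite -addSn => /IHw[x [y [-> dx dy]]].
  by exists (true :: x), y.
case: k => [dw|k /IHw[x [y [-> dx dy]]]]; first by exists [::], w.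
by exists (false :: x), y.
Qed.

Lemma dyck_from_cat_inj (k : nat) (x x' y y' : seq bool) :
  dyck_from k x -> dyck_from k x' ->
  x ++ false :: y = x' ++ false :: y' -> x = x' /\ y = y'.
Proof.
elim: x x' k => [|s x IHx] [|s' x'] k /=.
- by move=> _ _ [->].
- by move/eqP-> => /[swap] -[<- _].
- by move=> /[swap] /eqP-> /[swap] -[-> _].
- move=> dx dx' [es]; move: dx dx'; rewrite -es.
  case: s {es}; last case: k => // k.
  + by move=> dx dx' /(IHx _ _ dx dx')[-> ->].
  + by move=> dx dx' /(IHx _ _ dx dx')[-> ->].
Qed.

Lemma first_return_inj (x x' y y' : seq bool) :
  is_dyck x -> is_dyck x' ->
  first_return x y = first_return x' y' -> x = x' /\ y = y'.
Proof. by rewrite !is_dyckE => dx dx' []; apply: dyck_from_cat_inj dx dx'. Qed.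

Lemma dyck_first_return (x y : seq bool) :
  is_dyck x -> is_dyck y -> is_dyck (first_return x y).
Proof. by rewrite !is_dyckE => dx dy /=; rewrite (dyck_from_cat 0 1). Qed.

Lemma dyck_first_returnP (w : seq bool) :
  is_dyck w -> w != [::] ->
  exists x y, [/\ w = first_return x y, is_dyck x & is_dyck y].
Proof.
rewrite is_dyckE; case: w => [|[] w] //= dw _.
have [x [y [-> dx dy]]] := dyck_from_split 0 0 w dw.
by exists x, y; rewrite !is_dyckE.
Qed.

Lemma area_first_return (x y : seq bool) :
  is_dyck x ->
  area (first_return x y) = area x + (size x)%:Z + 1 + area y.
Proof.
move=> dx; rewrite area_cons area_cat area_cons (dyck_height_size dx).
rewrite size_cat /= /step; lia.
Qed.

Lemma valley_levels_first_return (x y : seq bool) :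
  is_dyck x -> is_dyck y ->
  valley_levels (first_return x y) =
  [seq 1 + l | l <- valley_levels x]
    ++ (if y == [::] then [::] else 0 :: valley_levels y).
Proof.
move=> dx dy; rewrite valley_levels_cons /= valley_levels_cat_down map_cat.
rewrite (dyck_height_size dx) valley_levels_cons dyck_head //.
have unlift (s : seq int) :
    [seq 1 + l | l <- [seq 0 + l | l <- [seq step false + l | l <- s]]] = s.
  by rewrite -!map_comp -[RHS]map_id; apply: eq_map => l /=; rewrite /step; lia.
rewrite !map_cat unlift; congr (_ ++ _).
by case: eqP => [->|].
Qed.

(** * Three classes of Dyck paths and their first return decompositions *)

(** No valley is more than one level below the previous one: a Dyck path is
    (-1)-Dyck when it satisfies [gentle]. *)
Definition gentle (w : seq bool) : bool :=
  sorted (fun l l' : int => - 1 <= l' - l) (valley_levels w).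

(** A path without valleys; for a Dyck path, a single pyramid, possibly empty. *)
Definition pyramid (w : seq bool) : bool := valley_levels w == [::].

(** On Dyck paths: a (-1)-Dyck path with no valley or with its last valley on
    the axis; the default value 0 of [last] puts the pyramids into this class. *)
Definition grounded (w : seq bool) : bool :=
  gentle w && (last 0 (valley_levels w) == 0).

(** With [s] and [t] the valley levels of [x] and [y]: the last valley of the
    lifted [x] is at most one level above the valley on the axis that precedes
    [y], so the last valley of [x] is on the axis; the valleys of [y] are not
    constrained by those before. *)
Lemma sorted_lift_cat (s t : seq int) :
  all (fun l => 0 <= l) s -> all (fun l => 0 <= l) t ->
  sorted (fun l l' : int => - 1 <= l' - l) ([seq 1 + l | l <- s] ++ 0 :: t) =
  sorted (fun l l' : int => - 1 <= l' - l) s && (last 0 s == 0)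
    && sorted (fun l l' : int => - 1 <= l' - l) t.
Proof.
move=> s0 t0.
have path0 : path (fun l l' : int => - 1 <= l' - l) 0 t =
    sorted (fun l l' : int => - 1 <= l' - l) t.
  by case: t t0 => //= l t /andP[l0 _]; lia.
case: s s0 => [|l s] s0; first by rewrite /= path0.
rewrite /= cat_path path_map last_map -path0 -andbA; congr andb.
  by apply: eq_path => u v /=; lia.
rewrite /=; congr andb.
have : 0 <= last l s by apply: (allP s0); exact: mem_last.
lia.
Qed.

Lemma sorted_lift (s : seq int) :
  sorted (fun l l' : int => - 1 <= l' - l) [seq 1 + l | l <- s] =
  sorted (fun l l' : int => - 1 <= l' - l) s.
Proof. by rewrite sorted_map; apply: eq_sorted => u v /=; lia. Qed.

(** Membership in the class [p] is decided on the first return decomposition: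
    by [p0] if the path returns only at its end, and otherwise by [pl] for the
    lifted part and by [pr] for the rest. *)
Definition first_return_rule (p p0 pl pr : pred (seq bool)) : Prop :=
  forall x y, is_dyck x -> is_dyck y ->
    p (first_return x y) = if y == [::] then p0 x else pl x && pr y.

Lemma gentle_first_return :
  first_return_rule gentle gentle grounded gentle.
Proof.
move=> x y dx dy; rewrite /grounded /gentle valley_levels_first_return //.
case: eqP => _; first by rewrite cats0 sorted_lift.
by rewrite sorted_lift_cat ?dyck_valley_levels_ge0.
Qed.

Lemma grounded_first_return :
  first_return_rule grounded pyramid grounded grounded.
Proof.
move=> x y dx dy; rewrite {1}/grounded gentle_first_return //.
rewrite valley_levels_first_return //; case: eqP => _; last first.
  by rewrite last_cat /= -andbA.
rewrite cats0 /gentle /pyramid; move: (dyck_valley_levels_ge0 _ dx).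
case: (valley_levels x) => [|l s] // l0; rewrite /= last_map andbC.
have : 0 <= last l s by apply: (allP l0); exact: mem_last.
by case: eqP => //; lia.
Qed.

(** A path that returns to the axis before its end has a valley, whence the two
    empty classes. *)
Lemma pyramid_first_return :
  first_return_rule pyramid pyramid pred0 pred0.
Proof.
move=> x y dx dy; rewrite /pyramid valley_levels_first_return //.
by case: (y =P [::]) => _; case: (valley_levels x).
Qed.

(** * Summation over the Dyck paths of a given semi-length *)

(** The Dyck paths of semi-length [n], without repetition. *)
Definition dyck_words (n : nat) : seq (seq bool) :=
  [seq w <- [seq val t | t : (n.*2).-tuple bool] | is_dyck w].

Lemma mem_dyck_words (n : nat) (w : seq bool) :
  (w \in dyck_words n) = is_dyck w && (size w == n.*2).
Proof.
rewrite mem_filter; congr (_ && _); apply/mapP/eqP => [[t _ ->]|sw].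
  exact: size_tuple.
by exists (tcast sw (in_tuple w)); rewrite ?mem_enum //= val_tcast.
Qed.

Lemma dyck_words_uniq (n : nat) : uniq (dyck_words n).
Proof. by rewrite filter_uniq // map_inj_uniq ?enum_uniq //; apply: val_inj. Qed.

Lemma dyck_words0 : dyck_words 0 = [:: [::]].
Proof.
apply/perm_small_eq => //; apply: uniq_perm (dyck_words_uniq 0) _ _ => // w.
rewrite mem_dyck_words size_eq0 inE andbC.
by case: eqP => // ->.
Qed.

(** A nonempty Dyck path is uniquely the first return composite of two Dyck
    paths whose semi-lengths sum to one less. *)
Lemma dyck_words_first_return (n : nat) :
  perm_eq (dyck_words n.+1)
    [seq first_return p.1 p.2
       | i <- index_iota 0 n.+1,
         p <- [seq (x, y) | x <- dyck_words i, y <- dyck_words (n - i)]].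
Proof.
apply: uniq_perm; first exact: dyck_words_uniq.
  apply: allpairs_uniq_dep; first exact: iota_uniq.
    move=> i _; apply: allpairs_uniq; try exact: dyck_words_uniq.
    by case=> x y [x' y'] _ _ /= [-> ->].
  move=> u v /allpairsPdep[i [p [_ pi ->]]] /allpairsPdep[j [p' [_ pj ->]]].
  case/allpairsP: pi => [[x y] /= [xi _ ->]].
  case/allpairsP: pj => [[x' y'] /= [xj _ ->]].
  move: xi xj; rewrite !mem_dyck_words => /andP[dx sx] /andP[dx' sx'].
  case/(first_return_inj _ _ _ _ dx dx') => ex ->.
  have -> : i = j by apply: double_inj; rewrite -(eqP sx) -(eqP sx') ex.
  by rewrite ex.
move=> w; rewrite mem_dyck_words; apply/andP/allpairsPdep => [[dw /eqP sw]|].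
  have [|x [y [ew dx dy]]] := dyck_first_returnP w dw; first by case: w sw {dw}.
  have sx := dyck_size x dx; have sy := dyck_size y dy.
  move: sw; rewrite ew /= size_cat /= sx sy => sij.
  exists (semilength x), (x, y); split=> //; first by rewrite mem_index_iota; lia.
  apply/allpairsP; exists (x, y); split=> //=; rewrite mem_dyck_words ?dx ?dy.
    by rewrite sx eqxx.
  by rewrite sy; apply/eqP; lia.
case=> i [p []]; rewrite mem_index_iota => lein /allpairsP[[x y] /= []].
rewrite !mem_dyck_words => /andP[dx /eqP sx] /andP[dy /eqP sy] -> ->.
split; first exact: dyck_first_return.
by rewrite /= size_cat /= sx sy; apply/eqP; lia.
Qed.

(** The paths that return to the axis only at their end give the first sum. *)
Lemma sum_first_return (p p0 pl pr : pred (seq bool)) :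
  first_return_rule p p0 pl pr ->
  forall (F : seq bool -> int) (n : nat),
  \sum_(w <- dyck_words n.+1 | p w) F w =
  \sum_(x <- dyck_words n | p0 x) F (first_return x [::])
  + \sum_(0 <= i < n) \sum_(x <- dyck_words i | pl x)
      \sum_(y <- dyck_words (n - i) | pr y) F (first_return x y).
Proof.
move=> pE F n; rewrite big_mkcond (perm_big _ (dyck_words_first_return n)).
rewrite big_allpairs_dep big_nat_recr //= addrC subnn dyck_words0; congr (_ + _).
  rewrite big_allpairs [RHS]big_mkcond; apply: eq_big_seq => x.
  by rewrite mem_dyck_words big_seq1 => /andP[dx _]; rewrite pE.
apply: eq_big_nat => i /andP[_ ltin].
rewrite big_allpairs [RHS]big_mkcond; apply: eq_big_seq => x.
rewrite mem_dyck_words => /andP[dx _]; case: ifP => plx; last first.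
  apply: big1_seq => y; rewrite mem_dyck_words => /andP[_ /andP[dy /eqP sy]].
  by rewrite /= pE // plx; case: eqP sy => // ->; move: ltin; rewrite /=; lia.
rewrite [RHS]big_mkcond; apply: eq_big_seq => y.
rewrite mem_dyck_words => /andP[dy /eqP sy].
rewrite /= pE // plx; case: eqP sy => // ->; rewrite /=; lia.
Qed.

(** The number, and the total area, of the Dyck paths of semi-length [n] that
    satisfy [p]. *)
Definition dyck_count (p : pred (seq bool)) (n : nat) : int :=
  \sum_(w <- dyck_words n | p w) 1.
Definition dyck_area (p : pred (seq bool)) (n : nat) : int :=
  \sum_(w <- dyck_words n | p w) area w.

Lemma dyck_count_first_return (p p0 pl pr : pred (seq bool)) :
  first_return_rule p p0 pl pr ->
  forall n, dyck_count p n.+1 =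
    dyck_count p0 n + \sum_(0 <= i < n) dyck_count pl i * dyck_count pr (n - i).
Proof.
move=> pE n; rewrite /dyck_count (sum_first_return _ _ _ _ pE); congr (_ + _).
apply: eq_bigr => i _; rewrite mulr_suml; apply: eq_bigr => x _.
by rewrite mul1r.
Qed.

Lemma dyck_area_first_return (p p0 pl pr : pred (seq bool)) :
  first_return_rule p p0 pl pr ->
  forall n, dyck_area p n.+1 =
    dyck_area p0 n + (n.*2.+1)%:Z * dyck_count p0 n
    + \sum_(0 <= i < n)
        ((dyck_area pl i + (i.*2.+1)%:Z * dyck_count pl i)
           * dyck_count pr (n - i)
         + dyck_count pl i * dyck_area pr (n - i)).
Proof.
move=> pE n; rewrite /dyck_count /dyck_area (sum_first_return _ _ _ _ pE).
congr (_ + _).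
  rewrite mulr_sumr -big_split big_seq_cond [RHS]big_seq_cond /=.
  apply: eq_bigr => x; rewrite mem_dyck_words => /andP[/andP[dx /eqP sx] _].
  by rewrite area_first_return // sx /area big_nat1 height0; lia.
apply: eq_bigr => i _.
transitivity (\sum_(x <- dyck_words i | pl x)
  ((area x + (i.*2.+1)%:Z * 1) * dyck_count pr (n - i)
     + 1 * dyck_area pr (n - i))); last first.
  by rewrite big_split /= -!mulr_suml big_split /= -mulr_sumr.
rewrite big_seq_cond [RHS]big_seq_cond.
apply: eq_bigr => x; rewrite mem_dyck_words => /andP[/andP[dx /eqP sx] _].
rewrite /dyck_count /dyck_area mulr_sumr mulr_sumr -big_split /=.
by apply: eq_bigr => y _; rewrite area_first_return // sx; lia.
Qed.

Lemma dyck_count0 (p : pred (seq bool)) : dyck_count p 0 = (p [::])%:R.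
Proof. by rewrite /dyck_count dyck_words0 big_cons big_nil; case: (p _). Qed.

Lemma dyck_area0 (p : pred (seq bool)) : dyck_area p 0 = 0.
Proof.
rewrite /dyck_area dyck_words0 big_cons big_nil /area big_nat1 height0.
by rewrite addr0 if_same.
Qed.

Lemma dyck_count_pyramid (n : nat) : dyck_count pyramid n = 1.
Proof.
elim: n => [|n IHn]; first by rewrite dyck_count0.
rewrite (dyck_count_first_return _ _ _ _ pyramid_first_return) IHn.
by rewrite big1 ?addr0 // => i _; rewrite {1}/dyck_count big_pred0_eq mul0r.
Qed.

Lemma dyck_area_pyramid (n : nat) : dyck_area pyramid n = n%:Z ^+ 2.
Proof.
elim: n => [|n IHn]; first by rewrite dyck_area0.
rewrite (dyck_area_first_return _ _ _ _ pyramid_first_return) IHn.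
rewrite dyck_count_pyramid big1 => [|i _]; first by lia.
by rewrite /dyck_count /dyck_area !big_pred0_eq !(mulr0, mul0r, addr0).
Qed.

(** * The four sequences of the statement *)

Lemma sum_tuple_dyck (n : nat) (p : pred (seq bool)) (F : seq bool -> int) :
  \sum_(w : (n.*2).-tuple bool | is_dyck w && p w) F w =
  \sum_(w <- dyck_words n | p w) F w.
Proof. by rewrite big_filter_cond big_image_cond. Qed.

Lemma mem_m1dyck (n : nat) (w : (n.*2).-tuple bool) :
  (w \in m1dyck n) = is_dyck w && gentle w.
Proof.
rewrite inE /is_m1dyck -andbA; case dw: (is_dyck w) => //=.
have /double_inj <- : n.*2 = (semilength w).*2.
  by rewrite -dyck_size // size_tuple.
by rewrite eqxx andbT.
Qed.

Lemma mem_Qset (n : nat) (w : (n.*2).-tuple bool) :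
  (w \in Qset n) = is_dyck w && (grounded w && ~~ pyramid w).
Proof.
by rewrite inE mem_m1dyck /grounded /pyramid andbC; do !case: (_ == _) => //=;
  rewrite ?andbT ?andbF.
Qed.

Lemma r_dyck_count (n : nat) : (r n)%:Z = dyck_count gentle n.
Proof.
rewrite /dyck_count -(sum_tuple_dyck _ _ (fun=> 1)) /r -sum1_card.
rewrite (big_morph _ PoszD erefl).
by apply: eq_bigl => w; rewrite mem_m1dyck.
Qed.

Lemma a_dyck_area (n : nat) : a n = dyck_area gentle n.
Proof.
by rewrite /dyck_area -sum_tuple_dyck; apply: eq_bigl => w; rewrite mem_m1dyck.
Qed.

Lemma sum_grounded (n : nat) (F : seq bool -> int) :
  \sum_(w <- dyck_words n | grounded w) F w =
  \sum_(w in Qset n) F w + \sum_(w <- dyck_words n | pyramid w) F w.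
Proof.
rewrite (bigID pyramid) addrC /=; congr (_ + _).
  apply: eq_bigl => w; rewrite /grounded /gentle /pyramid.
  by case: (valley_levels w =P [::]) => [->|_] /=; rewrite ?andbF.
by rewrite -sum_tuple_dyck; apply: eq_bigl => w; rewrite mem_Qset.
Qed.

Lemma q_dyck_count (n : nat) : (q n)%:Z = dyck_count grounded n - 1.
Proof.
rewrite -[X in _ - X](dyck_count_pyramid n) /dyck_count sum_grounded addrK.
by rewrite /q -sum1_card (big_morph _ PoszD erefl).
Qed.

Lemma A_dyck_area (n : nat) : A n = dyck_area grounded n - n%:Z ^+ 2.
Proof.
by rewrite -(dyck_area_pyramid n) /dyck_area sum_grounded addrK.
Qed.

(** * Convolution recurrences *)

Lemma convolution_sub (f g : nat -> int) (n : nat) :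
  \sum_(0 <= i < n.+1) f i * g (n.+1 - i)%N
    - \sum_(0 <= i < n) f i * g (n - i)%N =
  \sum_(0 <= i < n) f i * (g (n.+1 - i)%N - g (n - i)%N) + f n * g 1%N.
Proof.
rewrite big_nat_recr //= subSnn addrAC -sumrB; congr (_ + _).
by apply: eq_bigr => i _; rewrite mulrBr.
Qed.

Lemma convolution_sym (f g : nat -> int) (n : nat) :
  \sum_(0 <= i < n) f i * g (n - i)%N =
  \sum_(0 <= i < n) g i * f (n - i)%N + g n * f 0%N - g 0%N * f n.
Proof.
have full : \sum_(0 <= i < n.+1) f i * g (n - i)%N =
            \sum_(0 <= i < n.+1) g i * f (n - i)%N.
  rewrite big_nat_rev; apply: eq_big_nat => i /andP[_ ltin].
  by rewrite add0n subSS subKn // mulrC.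
move: full; rewrite !big_nat_recr //= !subnn => full.
by rewrite -full [f n * _]mulrC addrK.
Qed.

Lemma grounded_count_rec (n : nat) :
  dyck_count grounded n.+1 =
  1 + \sum_(0 <= i < n) dyck_count grounded i * dyck_count grounded (n - i).
Proof.
by rewrite (dyck_count_first_return _ _ _ _ grounded_first_return)
  dyck_count_pyramid.
Qed.

Lemma gentle_count_rec (n : nat) :
  dyck_count gentle n.+1 =
  dyck_count gentle n
  + \sum_(0 <= i < n) dyck_count grounded i * dyck_count gentle (n - i).
Proof. exact: dyck_count_first_return gentle_first_return n. Qed.

(** The two cross terms of the area convolution agree by symmetry, and the
    constant part of its weights is absorbed by the recurrence for the counts. *)
Lemma grounded_area_rec (n : nat) :
  dyck_area grounded n.+1 =
  dyck_area grounded n + n.+1%:Z ^+ 2 - 1 + dyck_count grounded n.+1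
  + 2 * \sum_(0 <= i < n)
          (dyck_area grounded i + i%:Z * dyck_count grounded i)
            * dyck_count grounded (n - i).
Proof.
rewrite (dyck_area_first_return _ _ _ _ grounded_first_return).
rewrite dyck_area_pyramid dyck_count_pyramid big_split /=.
rewrite [X in _ + (_ + X)]convolution_sym dyck_count0 dyck_area0 /=.
rewrite grounded_count_rec mul0r subr0.
pose S0 := \sum_(0 <= i < n) dyck_count grounded i * dyck_count grounded (n - i).
pose S1 := \sum_(0 <= i < n) dyck_area grounded i * dyck_count grounded (n - i).
pose S2 := \sum_(0 <= i < n)
  (i%:Z * dyck_count grounded i) * dyck_count grounded (n - i).
have -> : \sum_(0 <= i < n)
    (dyck_area grounded i + (i.*2.+1)%:Z * dyck_count grounded i)
      * dyck_count grounded (n - i) = S1 + 2 * S2 + S0.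
  rewrite /S1 /S2 /S0 mulr_sumr -!big_split /=; apply: eq_bigr => i _.
  by have -> : (i.*2.+1)%:Z = 2 * i%:Z + 1 by [lia]; ring.
have -> : \sum_(0 <= i < n)
    (dyck_area grounded i + i%:Z * dyck_count grounded i)
      * dyck_count grounded (n - i) = S1 + S2.
  by rewrite /S1 /S2 -big_split /=; apply: eq_bigr => i _; ring.
rewrite -/S0 -/S1; have -> : (n.*2.+1)%:Z = 2 * n%:Z + 1 by lia.
by have -> : n.+1%:Z = n%:Z + 1 by [lia]; ring.
Qed.

Lemma gentle_area_rec (n : nat) :
  dyck_area gentle n.+1 =
  dyck_area gentle n + (n.*2.+1)%:Z * dyck_count gentle n
  + \sum_(0 <= i < n)
      (dyck_area grounded i + (i.*2.+1)%:Z * dyck_count grounded i)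
        * dyck_count gentle (n - i)
  + \sum_(0 <= i < n) dyck_count grounded i * dyck_area gentle (n - i).
Proof.
by rewrite (dyck_area_first_return _ _ _ _ gentle_first_return) big_split addrA.
Qed.

Lemma grounded_small :
  [/\ dyck_count grounded 0 = 1, dyck_count grounded 1 = 1,
      dyck_count grounded 2 = 2 & dyck_count grounded 3 = 4].
Proof.
have b0 : dyck_count grounded 0 = 1 by rewrite dyck_count0.
have b1 : dyck_count grounded 1 = 1 by rewrite grounded_count_rec big_geq.
have b2 : dyck_count grounded 2 = 2.
  by rewrite grounded_count_rec !big_nat_recl // big_geq //= ?b0 ?b1.
split=> //; rewrite grounded_count_rec !big_nat_recl // big_geq //=.
by rewrite ?b0 ?b1 ?b2.
Qed.

Lemma grounded_area_small :
  [/\ dyck_area grounded 0 = 0, dyck_area grounded 1 = 1,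
      dyck_area grounded 2 = 6, dyck_area grounded 3 = 22
    & dyck_area grounded 4 = 74].
Proof.
have [b0 b1 b2 b3] := grounded_small.
have b4 : dyck_count grounded 4 = 9.
  by rewrite grounded_count_rec !big_nat_recl // big_geq //= b0 b1 b2 b3.
have c0 : dyck_area grounded 0 = 0 by rewrite dyck_area0.
have c1 : dyck_area grounded 1 = 1.
  by rewrite grounded_area_rec big_geq // c0 b1.
have c2 : dyck_area grounded 2 = 6.
  by rewrite grounded_area_rec !big_nat_recl // big_geq //= c0 c1 b0 b1 b2.
have c3 : dyck_area grounded 3 = 22.
  rewrite grounded_area_rec !big_nat_recl // big_geq //=.
  by rewrite c0 c1 c2 b0 b1 b2 b3.
split=> //; rewrite grounded_area_rec !big_nat_recl // big_geq //=.
by rewrite c0 c1 c2 c3 b0 b1 b2 b3 b4.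
Qed.

(** * The recurrences for the total areas *)

Lemma sum_split_ends (F : nat -> int) (n : nat) :
  (2 <= n)%N ->
  \sum_(0 <= i < n.+1) F i = F 0%N + F 1%N + \sum_(2 <= i < n) F i + F n.
Proof.
case: n => [|[|n]] // _.
by rewrite big_nat_recr //= big_ltn // big_ltn // !addrA.
Qed.

Lemma sum_split_start (F : nat -> int) (n : nat) :
  (2 <= n)%N -> \sum_(0 <= i < n) F i = F 0%N + F 1%N + \sum_(2 <= i < n) F i.
Proof. by case: n => [|[|n]] // _; rewrite big_ltn // big_ltn // addrA. Qed.

Lemma A_recurrence (n : nat) :
  (4 < n)%N ->
  A n = 2 * A (n - 1) + A (n - 2) + 2 * A (n - 3)
        + (q n)%:Z - (q (n - 1))%:Z
        + 2 * n%:Z * (q (n - 2))%:Z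
        + 2 * (n%:Z - 5) * (q (n - 3))%:Z
        + 4 * n%:Z ^+ 2 - 14 * n%:Z + 13
        + \sum_(2 <= i < (n - 4).+1)
            2 * (A i + i%:Z * (q i)%:Z + i%:Z * (i%:Z + 1))
              * ((q (n - i - 1))%:Z - (q (n - i - 2))%:Z).
Proof.
case: n => [|[|[|k]]] // lt1k; have {lt1k} le2k : (2 <= k)%N by lia.
have -> : (k.+3 - 1 = k.+2)%N by lia.
have -> : (k.+3 - 2 = k.+1)%N by lia.
have -> : (k.+3 - 3 = k)%N by lia.
have -> : (k.+3 - 4).+1 = k by lia.
pose g i := dyck_area grounded i + i%:Z * dyck_count grounded i.
pose b := dyck_count grounded.
have -> : \sum_(2 <= i < k)
    2 * (A i + i%:Z * (q i)%:Z + i%:Z * (i%:Z + 1))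
      * ((q (k.+3 - i - 1))%:Z - (q (k.+3 - i - 2))%:Z) =
  2 * \sum_(2 <= i < k) g i * (b (k.+2 - i)%N - b (k.+1 - i)%N).
  rewrite mulr_sumr; apply: eq_big_nat => i /andP[_ ltik].
  have -> : (k.+3 - i - 1 = k.+2 - i)%N by lia.
  have -> : (k.+3 - i - 2 = k.+1 - i)%N by lia.
  by rewrite !q_dyck_count A_dyck_area /g /b; ring.
(* The convolution runs over the indices 0 to [k]; the terms of index 0, 1 and
   [k] are the ones missing from the sum of the statement. *)
have := convolution_sub g b k.+1; rewrite [in RHS]sum_split_ends //.
have -> : (k.+2 - 1 = k.+1)%N by lia.
have -> : (k.+1 - 1 = k)%N by lia.
have -> : (k.+2 - k = 2)%N by lia.
have -> : (k.+1 - k = 1)%N by lia.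
have [_ b1 b2 _] := grounded_small; have [c0 c1 _ _ _] := grounded_area_small.
have [g0 g1] : g 0%N = 0 /\ g 1%N = 2 by rewrite /g c0 c1 b1 mul0r.
have [-> ->] : b 1%N = 1 /\ b 2%N = 2 by [].
rewrite g0 g1.
have := grounded_area_rec k.+2; have := grounded_area_rec k.+1.
rewrite !q_dyck_count !A_dyck_area.
move: (\sum_(2 <= i < k) _) => S; rewrite -/b.
move: (\sum_(0 <= i < k.+1) _) (\sum_(0 <= i < k.+2) _) => S1 S2.
have [-> -> ->] : [/\ k.+1%:Z = k%:Z + 1, k.+2%:Z = k%:Z + 2
                    & k.+3%:Z = k%:Z + 3] by split; lia.
move=> e1 e2 e3.
have twoS1 : 2 * S1 = dyck_area grounded k.+2 - dyck_area grounded k.+1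
    - (k%:Z + 2) ^+ 2 + 1 - b k.+2 by rewrite e1 /b; ring.
have e3' : 2 * S2 = 2 * S1 + 2 * (S2 - S1) by ring.
rewrite e2 e3' twoS1 e3 /b /g; ring.
Qed.

Lemma a_recurrence (n : nat) :
  (4 <= n)%N ->
  a n = 3 * a (n - 1) - a (n - 2) + A (n - 2)
        + 2 * (n%:Z - 1) * (q (n - 2))%:Z
        + 2 * n%:Z * (r (n - 1))%:Z
        + 2 * (3 - n%:Z) * (r (n - 2))%:Z
        - 4 * (r (n - 3))%:Z
        + (n%:Z - 1) ^+ 2
        + \sum_(3 <= i < (n - 2).+1)
            (q (i - 1))%:Z * (a (n - i) - a (n - i - 1))
        + \sum_(3 <= i < (n - 2).+1)
            (A (i - 1) + (2 * i%:Z - 1) * (q (i - 1))%:Z + i%:Z ^+ 2)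
              * ((r (n - i))%:Z - (r (n - i - 1))%:Z).
Proof.
case: n => [|[|m]] // lt1m; have {lt1m} le2m : (2 <= m)%N by lia.
have -> : (m.+2 - 1 = m.+1)%N by lia.
have -> : (m.+2 - 2 = m)%N by lia.
have -> : (m.+2 - 3 = m - 1)%N by lia.
pose b := dyck_count grounded.
pose f i := dyck_area grounded i + (i.*2.+1)%:Z * b i.
pose s := dyck_count gentle.
pose t := dyck_area gentle.
rewrite [X in _ + X + _]big_add1 [X in _ + X]big_add1 -[m.+1.-1]/m.
have -> : \sum_(2 <= i < m)
    (q (i.+1 - 1))%:Z * (a (m.+2 - i.+1) - a (m.+2 - i.+1 - 1)) =
  \sum_(2 <= i < m) b i * (t (m.+1 - i)%N - t (m - i)%N)
  - (t (m - 1)%N - t 1%N).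
  (* The constant part of [q i = b i - 1] telescopes. *)
  have <- : \sum_(2 <= i < m) (t (m.+1 - i)%N - t (m - i)%N) =
            t (m - 1)%N - t 1%N.
    have := telescope_sumr (fun i => - t (m.+1 - i)%N) le2m.
    have -> : (m.+1 - m = 1)%N by lia.
    have -> : (m.+1 - 2 = m - 1)%N by lia.
    rewrite opprK [RHS]addrC => <-; apply: eq_bigr => i _.
    by rewrite subSS opprK addrC.
  rewrite -sumrB; apply: eq_big_nat => i /andP[_ ltim].
  have -> : (i.+1 - 1 = i)%N by lia.
  have -> : (m.+2 - i.+1 - 1 = m - i)%N by lia.
  by rewrite subSS !a_dyck_area q_dyck_count /b /t; ring.
have -> : \sum_(2 <= i < m)
    (A (i.+1 - 1) + (2 * i.+1%:Z - 1) * (q (i.+1 - 1))%:Z + i.+1%:Z ^+ 2)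
      * ((r (m.+2 - i.+1))%:Z - (r (m.+2 - i.+1 - 1))%:Z) =
  \sum_(2 <= i < m) f i * (s (m.+1 - i)%N - s (m - i)%N).
  apply: eq_big_nat => i /andP[_ ltim].
  have -> : (i.+1 - 1 = i)%N by lia.
  have -> : (m.+2 - i.+1 - 1 = m - i)%N by lia.
  rewrite subSS !r_dyck_count q_dyck_count A_dyck_area /f /b /s.
  have -> : i.+1%:Z = i%:Z + 1 by lia.
  by have -> : (i.*2.+1)%:Z = 2 * i%:Z + 1 by [lia]; ring.
have := convolution_sub f s m; rewrite [in RHS]sum_split_start //.
have := convolution_sub b t m; rewrite [in RHS]sum_split_start //.
have -> : (m.+1 - 1 = m)%N by lia.
rewrite !subn0.
have [b0 b1 _ _] := grounded_small; have [c0 c1 _ _ _] := grounded_area_small.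
have [-> ->] : b 0%N = 1 /\ b 1%N = 1 by [].
have [-> ->] : f 0%N = 1 /\ f 1%N = 4.
  by rewrite /f /b c0 c1 b0 b1.
have s0 : s 0%N = 1 by rewrite /s dyck_count0.
have s1 : s 1%N = 1 by rewrite /s gentle_count_rec big_geq // -/s s0.
have t1 : t 1%N = 1.
  by rewrite /t gentle_area_rec !big_geq // -/s -/t s0 /t dyck_area0.
rewrite s1 t1.
have := gentle_area_rec m.+1; have := gentle_area_rec m.
rewrite !q_dyck_count !A_dyck_area !a_dyck_area !r_dyck_count -/b -/s -/t.
move: (\sum_(2 <= i < m) _) (\sum_(2 <= i < m) _) => S T.
move: (\sum_(0 <= i < m) _) (\sum_(0 <= i < m.+1) _) => S1 S2.
move: (\sum_(0 <= i < m) _) (\sum_(0 <= i < m.+1) _) => T1 T2.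
rewrite {}/f.
have -> : (m.+1.*2.+1)%:Z = 2 * m%:Z + 3 by lia.
have -> : (m.*2.+1)%:Z = 2 * m%:Z + 1 by lia.
have -> : m.+2%:Z = m%:Z + 2 by lia.
move=> e1 e2 e3 e4.
have S1E : S1 + T1 = t m.+1 - t m - (2 * m%:Z + 1) * s m by rewrite e1; ring.
have S2E : S2 + T2 = S1 + T1 + (S2 - S1) + (T2 - T1) by ring.
by rewrite e2 -addrA S2E S1E e3 e4; ring.
Qed.

Theorem theorem4p2 :
  ((forall n : nat, (4 < n)%N ->
      A n = 2 * A (n - 1) + A (n - 2) + 2 * A (n - 3)
            + (q n)%:Z - (q (n - 1))%:Z
            + 2 * n%:Z * (q (n - 2))%:Z
            + 2 * (n%:Z - 5) * (q (n - 3))%:Z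
            + 4 * n%:Z ^+ 2 - 14 * n%:Z + 13
            + \sum_(2 <= i < (n - 4).+1)
                2 * (A i + i%:Z * (q i)%:Z + i%:Z * (i%:Z + 1))
                  * ((q (n - i - 1))%:Z - (q (n - i - 2))%:Z))
   /\ [/\ A 1 = 0, A 2 = 2, A 3 = 13 & A 4 = 58])
  /\
  (forall n : nat, (4 <= n)%N ->
      a n = 3 * a (n - 1) - a (n - 2) + A (n - 2)
            + 2 * (n%:Z - 1) * (q (n - 2))%:Z
            + 2 * n%:Z * (r (n - 1))%:Z
            + 2 * (3 - n%:Z) * (r (n - 2))%:Z
            - 4 * (r (n - 3))%:Z
            + (n%:Z - 1) ^+ 2
            + \sum_(3 <= i < (n - 2).+1)
                (q (i - 1))%:Z * (a (n - i) - a (n - i - 1))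
            + \sum_(3 <= i < (n - 2).+1)
                (A (i - 1) + (2 * i%:Z - 1) * (q (i - 1))%:Z + i%:Z ^+ 2)
                  * ((r (n - i))%:Z - (r (n - i - 1))%:Z)).
Proof.
split; last exact: a_recurrence.
split; first exact: A_recurrence.
have [_ c1 c2 c3 c4] := grounded_area_small.
by rewrite !A_dyck_area c1 c2 c3 c4.
Qed.
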